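(* Let $k\ge 2$, let $R$ be a commutative ring with $1$, let $\Lambda=R[\mathbb{Z}_k]$, let $S_\bullet$ be the standard resolution and $M_\bullet$ the minimal resolution of $R$ over $\Lambda$, and let $f_r\colon S_r\to M_r=\Lambda$ ($r\ge 0$) be the $\Lambda$-linear maps defined on bar basis elements by $$f_{2s}([h_1|\cdots|h_{2s}])=\begin{cases} e,&\text{if }[h_1|\cdots|h_{2s}]\text{ is strongly alternating},\\ 0,&\text{otherwise,}\end{cases}$$ $$f_{2s+1}([h_1|\cdots|h_{2s+1}])=\sigma_i\, f_{2s}([h_2|\cdots|h_{2s+1}])\quad\text{for } h_1=g^i,\ 0\le i<k.$$ Then the collection of the maps $f_r$ is a chain map from the standard resolution to the minimal resolution; that is, for all $s\ge 0$, $$f_{2s}(\partial c)=\tau f_{2s+1}(c)\quad\text{for all } c\in S_{2s+1},\qquad f_{2s+1}(\partial c)=\sigma f_{2s+2}(c)\quad\text{for all } c\in S_{2s+2}.$$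
   Context: $\mathbb{Z}_k=\{e,g,\dots,g^{k-1}\}$ is the cyclic group of order $k$, written multiplicatively, with generator $g$. $\Lambda=R[\mathbb{Z}_k]$ is the group ring. Set $\tau=g-e$, $\sigma=e+g+\cdots+g^{k-1}$, and $\sigma_i=e+g+\cdots+g^{i-1}$ for $0\le i\le k$ (so $\sigma_0=0$, $\sigma_k=\sigma$). Standard resolution $S_\bullet$: $S_r=\Lambda\otimes_R\cdots\otimes_R\Lambda$ ($r+1$ factors), $r\ge0$, with $R$-basis the elements $h_0\otimes\cdots\otimes h_r$, $h_i\in\mathbb{Z}_k$; the boundary $\partial_r\colon S_r\to S_{r-1}$ ($r\ge1$) is the $R$-linear map with $\partial_r(h_0\otimes\cdots\otimes h_r)=\sum_{i=0}^r(-1)^i h_0\otimes\cdots\otimes\widehat{h_i}\otimes\cdots\otimes h_r$ ($\widehat{h_i}$ means omission). $S_r$ is a $\Lambda$-module via the diagonal action $h\cdot(h_0\otimes\cdots\otimes h_r)=hh_0\otimes\cdots\otimes hh_r$ for $h\in\mathbb{Z}_k$. The bar basis elements $[h_1|\cdots|h_r]:=e\otimes h_1\otimes h_1h_2\otimes\cdots\otimes h_1h_2\cdots h_r$ ($h_i\in\mathbb{Z}_k$; $[\,]=e\in S_0$) form a $\Lambda$-basis of $S_r$. Minimal resolution $M_\bullet$: $M_r=\Lambda$ for all $r\ge 0$; the boundary $\partial_r\colon M_r\to M_{r-1}$ ($r\ge1$) is multiplication by $\sigma$ if $r$ is even and by $\tau$ if $r$ is odd. Strongly alternating (even degree): an element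 $h_0\otimes\cdots\otimes h_{2s}$ with $h_i\in\mathbb{Z}_k$, written as $g^{a_0}[g^{a_1}|\cdots|g^{a_{2s}}]$ with $0\le a_i<k$, is strongly alternating if $a_{2i+1}+a_{2i+2}\ge k$ for all $0\le i\le s-1$. (For $s=0$ the condition is vacuous.) *)

(* Defs.v *)
From HB Require Import structures.
From mathcomp Require Import all_boot all_order all_algebra all_fingroup all_solvable.

Set Implicit Arguments.
Unset Strict Implicit.
Unset Printing Implicit Defensive.

Import GRing.Theory.
Local Open Scope ring_scope.

(* The canonical ring structure on {ffun gT -> R} is pointwise, hence an alias
   carrying only its additive structure, on which multiplication is convolution. *)
Definition groupRing (R : comPzRingType) (gT : finGroupType) := {ffun gT -> R}.

Section GroupRing.
Variables (R : comPzRingType) (gT : finGroupType).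
Local Notation A := (groupRing R gT).

HB.instance Definition _ := GRing.Zmodule.on A.

Definition gbase (h : gT) : A := [ffun x => (x == h)%:R].

Definition gr_mul (x y : A) : A :=
  [ffun h => \sum_(u : gT) x u * y (u^-1 * h)%g].

Fact gr_mulA : associative gr_mul.
Proof.
move=> x y z; apply/ffunP=> h; rewrite !ffunE.
under eq_bigr => u _ do rewrite ffunE mulr_sumr.
under [RHS]eq_bigr => u _ do rewrite ffunE mulr_suml.
rewrite [RHS]exchange_big /=; apply: eq_bigr => u _.
rewrite [RHS](reindex_inj (mulgI u)) /=; apply: eq_bigr => v _.
by rewrite mulKg invMg -mulgA mulrA.
Qed.

Fact gr_mul1 : left_id (gbase 1) gr_mul.
Proof.
move=> x; apply/ffunP=> h; rewrite ffunE (bigD1 1%g) //= big1 => [|u u1].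
  by rewrite ffunE eqxx mul1r invg1 mul1g addr0.
by rewrite ffunE (negPf u1) mul0r.
Qed.

Fact gr_mulr1 : right_id (gbase 1) gr_mul.
Proof.
move=> x; apply/ffunP=> h; rewrite ffunE (bigD1 h) //= big1 => [|u uh].
  by rewrite ffunE mulVg eqxx mulr1 addr0.
by rewrite ffunE -eq_mulVg1 (negPf uh) mulr0.
Qed.

Fact gr_mulDl : left_distributive gr_mul +%R.
Proof.
move=> x y z; apply/ffunP=> h; rewrite !ffunE -big_split /=.
by apply: eq_bigr => u _; rewrite ffunE mulrDl.
Qed.

Fact gr_mulDr : right_distributive gr_mul +%R.
Proof.
move=> x y z; apply/ffunP=> h; rewrite !ffunE -big_split /=.
by apply: eq_bigr => u _; rewrite ffunE mulrDr.
Qed.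

HB.instance Definition _ := GRing.Zmodule_isPzRing.Build A
  gr_mulA gr_mul1 gr_mulr1 gr_mulDl gr_mulDr.

Lemma gr_mulE (x y : A) h : (x * y) h = \sum_(u : gT) x u * y (u^-1 * h)%g.
Proof. by rewrite ffunE. Qed.

Lemma gbase1 : gbase 1 = 1.
Proof. by []. Qed.

Lemma gbaseM h1 h2 : gbase (h1 * h2)%g = gbase h1 * gbase h2.
Proof.
apply/ffunP=> h; rewrite gr_mulE (bigD1 h1) //= big1 => [|u uh].
  by rewrite !ffunE eqxx mul1r addr0 -(inj_eq (mulgI h1^-1%g)) mulKg.
by rewrite ffunE (negPf uh) mul0r.
Qed.

End GroupRing.

(* The (r+1)-fold tensor power of R[G] over R, as the free R-module on the
   elements h_0 (x) ... (x) h_r: an element is its family of coefficients. *)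
Definition stdRes (R : comPzRingType) (gT : finGroupType) (r : nat) :=
  {ffun r.+1.-tuple gT -> R}.

Section StandardResolution.
Variables (R : comPzRingType) (gT : finGroupType).
Local Notation A := (groupRing R gT).
Local Notation S := (stdRes R gT).

HB.instance Definition _ r := GRing.Zmodule.on (S r).

Definition tens r (h : r.+1.-tuple gT) : S r := [ffun u => (u == h)%:R].

Definition diag_act r (x : gT) (h : r.-tuple gT) : r.-tuple gT :=
  [tuple of map (mulg x) h].

Definition std_scale r (a : A) (c : S r) : S r :=
  [ffun h => \sum_(x : gT) a x * c (diag_act x^-1 h)].

Lemma diag_act1 r (h : r.-tuple gT) : diag_act 1 h = h.
Proof. by apply/eq_from_tnth=> i; rewrite tnth_map mul1g. Qed.

Lemma diag_actM r x y (h : r.-tuple gT) :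
  diag_act (x * y) h = diag_act x (diag_act y h).
Proof. by apply/eq_from_tnth=> i; rewrite !tnth_map mulgA. Qed.

Fact std_scaleA r a b (c : S r) :
  std_scale a (std_scale b c) = std_scale (a * b) c.
Proof.
apply/ffunP=> h; rewrite !ffunE.
under eq_bigr => x _ do rewrite ffunE mulr_sumr.
under [RHS]eq_bigr => x _ do rewrite gr_mulE mulr_suml.
rewrite [RHS]exchange_big /=; apply: eq_bigr => x _.
rewrite [RHS](reindex_inj (mulgI x)) /=; apply: eq_bigr => y _.
by rewrite mulKg invMg diag_actM mulrA.
Qed.

Fact std_scale1 r : left_id 1 (@std_scale r).
Proof.
move=> c; apply/ffunP=> h; rewrite ffunE (bigD1 1%g) //= big1 => [|x x1].
  by rewrite ffunE eqxx mul1r invg1 diag_act1 addr0.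
by rewrite ffunE (negPf x1) mul0r.
Qed.

Fact std_scaleDr r : right_distributive (@std_scale r) +%R.
Proof.
move=> a c d; apply/ffunP=> h; rewrite !ffunE -big_split /=.
by apply: eq_bigr => x _; rewrite ffunE mulrDr.
Qed.

Fact std_scaleDl r (c : S r) : {morph (@std_scale r)^~ c : a b / a + b}.
Proof.
move=> a b; apply/ffunP=> h; rewrite !ffunE -big_split /=.
by apply: eq_bigr => x _; rewrite ffunE mulrDl.
Qed.

HB.instance Definition _ r := GRing.Zmodule_isLmodule.Build A (S r)
  (@std_scaleA r) (@std_scale1 r) (@std_scaleDr r) (@std_scaleDl r).

Lemma std_scaleE r (a : A) (c : S r) h :
  (a *: c) h = \sum_(x : gT) a x * c (diag_act x^-1 h).
Proof. by rewrite ffunE. Qed.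

Lemma scale_tens r x (h : r.+1.-tuple gT) :
  gbase R x *: tens h = tens (diag_act x h).
Proof.
apply/ffunP=> u; rewrite std_scaleE (bigD1 x) //= big1 => [|y yx].
  rewrite !ffunE eqxx mul1r addr0; congr (_%:R); congr nat_of_bool.
  apply/eqP/eqP=> [<-|->]; rewrite -diag_actM ?mulgV ?mulVg diag_act1 //.
by rewrite ffunE (negPf yx) mul0r.
Qed.

Definition omit r (i : 'I_r.+1) (h : r.+1.-tuple gT) : r.-tuple gT :=
  [tuple tnth h (lift i j) | j < r].

Definition std_bd r (c : S r.+1) : S r :=
  [ffun v => \sum_(h : r.+2.-tuple gT) \sum_(i < r.+2 | omit i h == v)
     (-1) ^+ i * c h].

Lemma std_bd_tens r (h : r.+2.-tuple gT) :
  std_bd (tens h) = \sum_(i < r.+2) (-1) ^+ i *: tens (omit i h).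
Proof.
have sgn m (c : S r) v : ((-1) ^+ m *: c) v = (-1) ^+ m * c v.
  by elim: m => [|m IH]; rewrite ?scale1r ?mul1r // !exprS !mulN1r scaleNr
    ffunE IH mulNr.
apply/ffunP=> v; rewrite ffunE (bigD1 h) //= [X in _ + X]big1 => [|u uh].
  rewrite addr0 sum_ffunE big_mkcond /=; apply: eq_bigr => i _.
  by rewrite sgn !ffunE eqxx [v == _]eq_sym; case: eqP; rewrite ?mulr0.
by apply: big1 => i _; rewrite ffunE (negPf uh) mulr0.
Qed.

Fact omit_diag_act r (i : 'I_r.+1) x h :
  omit i (diag_act x h) = diag_act x (omit i h).
Proof.
by apply/eq_from_tnth=> j; rewrite !tnth_map !tnth_ord_tuple.
Qed.

Fact std_bd_is_linear r : linear (@std_bd r).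
Proof.
have diagK x n : cancel (@diag_act n x^-1) (@diag_act n x).
  by move=> h; rewrite -diag_actM mulgV diag_act1.
move=> a c d; apply/ffunP=> v; rewrite [RHS]ffunE std_scaleE !ffunE.
transitivity (\sum_(h : r.+2.-tuple gT) \sum_(i < r.+2 | omit i h == v)
    (-1) ^+ i * (a *: c) h +
  \sum_(h : r.+2.-tuple gT) \sum_(i < r.+2 | omit i h == v) (-1) ^+ i * d h).
  rewrite -big_split; apply: eq_bigr => h _; rewrite -big_split /=.
  by apply: eq_bigr => i _; rewrite ffunE mulrDr.
congr (_ + _).
transitivity (\sum_(h : r.+2.-tuple gT) \sum_(x : gT)
    \sum_(i < r.+2 | omit i h == v) (-1) ^+ i * (a x * c (diag_act x^-1 h))).
  apply: eq_bigr => h _; rewrite exchange_big; apply: eq_bigr => i _ /=.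
  by rewrite std_scaleE mulr_sumr.
rewrite exchange_big; apply: eq_bigr => x _ /=.
rewrite ffunE mulr_sumr.
have xK : cancel (@diag_act r.+2 x) (@diag_act r.+2 x^-1).
  by move=> h; rewrite -diag_actM mulVg diag_act1.
rewrite (reindex_inj (can_inj xK)) /=; apply: eq_bigr => h _.
rewrite mulr_sumr xK; apply: eq_big => i => [|_]; last by rewrite mulrCA.
rewrite omit_diag_act; apply/eqP/eqP=> [<-|->]; last exact: diagK.
by rewrite -diag_actM mulVg diag_act1.
Qed.

HB.instance Definition _ r := GRing.isLinear.Build A (S r.+1) (S r) *:%R
  (@std_bd r) (@std_bd_is_linear r).

Definition bar_tuple r (t : r.-tuple gT) : r.+1.-tuple gT :=
  [tuple (\prod_(x <- take j t) x)%g | j < r.+1].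

Definition bar r (t : r.-tuple gT) : S r := tens (bar_tuple t).

(* The coefficient in R[G] of c at the basis element bar t; see bar_decomp. *)
Definition bar_coef r (c : S r) (t : r.-tuple gT) : A :=
  [ffun x => c (diag_act x (bar_tuple t))].

Definition bar_extend r (V : lmodType A) (phi : r.-tuple gT -> V) (c : S r) : V :=
  \sum_(t : r.-tuple gT) bar_coef c t *: phi t.

Fact bar_extend_is_linear r (V : lmodType A) phi :
  linear (@bar_extend r V phi).
Proof.
move=> a c d; rewrite /bar_extend scaler_sumr -big_split /=.
apply: eq_bigr => t _; rewrite scalerA -scalerDl; congr (_ *: _).
apply/ffunP=> x; rewrite !ffunE; congr (_ + _).
by apply: eq_bigr => y _; rewrite ffunE diag_actM.
Qed.

HB.instance Definition _ r (V : lmodType A) phi := GRing.isLinear.Build A (S r) V *:%R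
  (@bar_extend r V phi) (@bar_extend_is_linear r V phi).

Lemma bar_tuple_inj r x y (t u : r.-tuple gT) :
  diag_act x (bar_tuple t) = diag_act y (bar_tuple u) -> x = y /\ t = u.
Proof.
move=> E.
have Ej (j : 'I_r.+1) :
    (x * \prod_(z <- take j t) z = y * \prod_(z <- take j u) z)%g.
  by have := congr1 (fun w => tnth w j) E; rewrite !tnth_map !tnth_ord_tuple.
have xy : x = y by have := Ej ord0; rewrite !take0 !big_nil !mulg1.
split=> //; rewrite {}xy in Ej; apply/eq_from_tnth=> j.
have Pj (m : 'I_r.+1) : (\prod_(z <- take m t) z = \prod_(z <- take m u) z)%g.
  exact: mulgI (Ej m).
have := Pj (lift ord0 j); have := Pj (widen_ord (leqnSn r) j).
rewrite lift0 /= !(take_nth 1%g) ?size_tuple //.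
rewrite -!cats1 !big_cat !big_seq1 /= => -> /mulgI.
by rewrite -!tnth_nth.
Qed.

Lemma bar_extend_bar r (V : lmodType A) phi (t : r.-tuple gT) :
  @bar_extend r V phi (bar t) = phi t.
Proof.
have coefE u : bar_coef (bar t) u = (u == t)%:R.
  apply/ffunP=> x; rewrite !ffunE.
  case: eqP => [E|nE].
    have [|-> ->] := @bar_tuple_inj r x 1 u t; first by rewrite diag_act1.
    by rewrite eqxx ffunE eqxx.
  case: eqP => [ut|_]; last by rewrite ffunE.
  rewrite ffunE; case: eqP => // x1; case: nE.
  by rewrite x1 ut diag_act1.
rewrite /bar_extend (bigD1 t) //= coefE eqxx scale1r big1 ?addr0 // => u ut.
by rewrite coefE (negPf ut) scale0r.
Qed.

Lemma bar_decomp r (c : S r) : c = \sum_(t : r.-tuple gT) bar_coef c t *: bar t.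
Proof.
have surj (h : r.+1.-tuple gT) : exists x t, h = diag_act x (bar_tuple t).
  pose a := nth 1%g h.
  exists (a 0%N), [tuple ((a i)^-1 * a i.+1)%g | i < r].
  apply/eq_from_tnth=> j; rewrite !tnth_map tnth_ord_tuple /=.
  rewrite (tnth_nth 1%g) -/(a j).
  have sz : size [seq ((a (val i))^-1 * a i.+1)%g | i : 'I_r <- enum 'I_r] = r.
    by rewrite size_map size_enum_ord.
  have : (j <= r)%N by rewrite -ltnS.
  elim: (val j) => [|m IH] mr; first by rewrite take0 big_nil mulg1.
  rewrite (take_nth 1%g) ?sz // -cats1 big_cat big_seq1 /= mulgA -IH 1?ltnW //.
  rewrite (nth_map (Ordinal mr)) ?size_enum_ord //.
  by rewrite (nth_enum_ord (Ordinal mr)) // mulKVg.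
apply/ffunP=> h; have [x [t ->]] := surj h; rewrite sum_ffunE.
rewrite (bigD1 t) //= std_scaleE (bigD1 x) //=.
rewrite -diag_actM mulVg diag_act1 !ffunE eqxx mulr1 -[LHS]addr0 -addrA.
congr (_ + _); apply/esym; rewrite !big1 ?addr0 // => [u ut|y yx].
  rewrite std_scaleE big1 // => y _; rewrite -diag_actM [bar _ _]ffunE.
  case: eqP; rewrite ?mulr0 // -[bar_tuple u]diag_act1 => /bar_tuple_inj[_ tu].
  by rewrite tu eqxx in ut.
rewrite -diag_actM [bar _ _]ffunE; case: eqP; rewrite ?mulr0 //.
rewrite -[RHS]diag_act1 => /bar_tuple_inj[/(canRL (mulKg _))].
by rewrite invgK mulg1 => xy; rewrite xy eqxx in yx.
Qed.

End StandardResolution.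

Section Cyclic.
Variables (R : comPzRingType) (gT : finGroupType) (g : gT).
Local Notation A := (groupRing R gT).
Local Notation k := #[g]%g.

Definition tau : A := gbase R g - 1.
Definition sigma_ (i : nat) : A := \sum_(j < i) gbase R (g ^+ j)%g.
Definition sigma : A := sigma_ k.

Definition minRes (r : nat) : lmodType A := A^o.

Definition min_bd (r : nat) (c : minRes r.+1) : minRes r :=
  (if odd r.+1 then tau else sigma) * (c : A).

(* The exponent 0 <= a < #[g] with g ^+ a = h (for h a power of g). *)
Definition expo (h : gT) : nat := find (fun a => (g ^+ a)%g == h) (iota 0 k).

Lemma expoP h : h \in <[g]>%g -> (g ^+ expo h)%g = h /\ (expo h < k)%N.
Proof.
move=> /cyclePmin[a a_lt ->].
have ex : has (fun b => (g ^+ b)%g == (g ^+ a)%g) (iota 0 k).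
  by apply/hasP; exists a; rewrite ?mem_iota.
have lt : (expo (g ^+ a)%g < k)%N by move: ex; rewrite has_find size_iota.
by split=> //; have := nth_find 0%N ex; rewrite nth_iota // add0n => /eqP.
Qed.

Lemma expoX a : (a < k)%N -> expo (g ^+ a)%g = a.
Proof.
move=> lt; have [E lt'] := expoP (mem_cycle g a).
by apply/eqP; have /eqP := E; rewrite eq_expg_mod_order !modn_small.
Qed.

(* For t = [:: h_1; ...; h_2s], strong alternation of the elements
   h_0[h_1|...|h_2s]; it does not depend on h_0. List indices start at 0. *)
Definition strongly_alternating (t : seq gT) : bool :=
  [forall i : 'I_(size t)./2,
     (k <= expo (nth 1%g t i.*2) + expo (nth 1%g t i.*2.+1))%N].

Definition fval_even (t : seq gT) : A :=
  if strongly_alternating t then 1 else 0.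

Definition fval r (t : r.-tuple gT) : minRes r :=
  if odd r then sigma_ (expo (head 1%g t)) * fval_even (behead t)
  else fval_even t.

Definition f (r : nat) : {linear stdRes R gT r -> minRes r} :=
  @bar_extend R gT r (minRes r) (@fval r).

Lemma f_bar_even s (t : (s.*2).-tuple gT) :
  f s.*2 (bar R t) = (if strongly_alternating t then 1 else 0 : A).
Proof. by rewrite /f /= bar_extend_bar /fval odd_double. Qed.

Lemma f_bar_odd s i (t : (s.*2).-tuple gT) : (i < k)%N ->
  f s.*2.+1 (bar R [tuple of (g ^+ i)%g :: t])
    = sigma_ i * (f s.*2 (bar R t) : A).
Proof.
move=> lt; rewrite f_bar_even /f /= bar_extend_bar /fval /= odd_double /=.
by rewrite expoX.
Qed.

End Cyclic.

Definition is_chain_map (A : pzRingType) (C D : nat -> lmodType A)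
    (dC : forall r, C r.+1 -> C r) (dD : forall r, D r.+1 -> D r)
    (phi : forall r, {linear C r -> D r}) : Prop :=
  forall r (c : C r.+1), phi r (dC r c) = dD r (phi r.+1 c).

(* Main.v *)
Require Import Defs.
From HB Require Import structures.
From mathcomp Require Import all_boot all_order all_algebra all_fingroup all_solvable.
From mathcomp Require Import zify.

Set Implicit Arguments.
Unset Strict Implicit.
Unset Printing Implicit Defensive.

Import GRing.Theory.
Local Open Scope ring_scope.

(** The maps f_r are cup products, and the statement is the Leibniz rule.

    Write c(x, y) in {0, 1} for the carry produced when the exponents of x and
    y are added modulo k.  Strong alternation of [h_1|...|h_2s] says that all
    the carries c(h_1, h_2), c(h_3, h_4), ... equal 1, so f_2s is the s-th cup
    power of c, and f_2s+1 is l cup f_2s for l(g^i) = sigma_i.  Two facts on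
    low-degree cochains then decide everything.

    - c is a 2-cocycle with trivial coefficients [carry_cocycle], because
      k c(x, y) = expo x + expo y - expo (xy) is a coboundary over the integers,
      where k can be cancelled.
      Hence so is its cup power [merge_sum_even].
    - The coboundary of l is sigma c [sigma_expo_coboundary]: sigma_(a + b) =
      sigma_a + g^a sigma_b, and the sum of the first a + b powers of g exceeds
      the one for the reduced exponent by sigma exactly when there is a carry.

    In odd degree, the coboundary of l cup c^s is (sigma c) cup c^s, that is
    sigma f_2s+2 [odd_coboundary].  In even degree, f_2s takes values in
    Lambda, where h_1 acts nontrivially on the first face; since c^s is a
    cocycle for the trivial action, only the defect (h_1 - e) c^s(h_2, ...)
    survives, and g^a - e = tau sigma_a makes it tau f_2s+1
    [even_coboundary].

    These are identities on the bar basis.  They extend to all chains because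
    both sides are Lambda-linear; for the boundary of the minimal resolution,
    left multiplication by tau or sigma, this uses commutativity of Lambda. *)

Section BarBoundary.
Variables (R : comPzRingType) (gT : finGroupType).
Local Notation A := (groupRing R gT).

(** In bar notation, the faces omitting a vertex other than the initial one;
    bar_merge s i omits the vertex i + 1.  Working on sequences rather than
    tuples allows induction on the leading entries. *)
Fixpoint bar_merge (s : seq gT) (i : nat) : seq gT :=
  if s is x :: s1 then
    if s1 is y :: s2 then
      if i is j.+1 then x :: bar_merge s1 j else (x * y)%g :: s2
    else [::]
  else [::].

Lemma size_bar_merge s i : size (bar_merge s i) = (size s).-1.
Proof. by elim: s i => [|x [|y s] IH] [|i] //=; rewrite IH. Qed.

Fact bar_merge_tupleP r (t : r.+1.-tuple gT) i :
  size (bar_merge t i) == r.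
Proof. by rewrite size_bar_merge size_tuple. Qed.

Definition bar_merge_tuple r (t : r.+1.-tuple gT) i : r.-tuple gT :=
  Tuple (bar_merge_tupleP t i).

(** Partial products are the vertices of a bar element, and merging two
    adjacent factors skips exactly one of them, the one of index i + 1. *)
Lemma prod_take_bar_merge (s : seq gT) i j : (i < size s)%N -> (j < size s)%N ->
  (\prod_(x <- take j (bar_merge s i)) x = \prod_(x <- take (bump i.+1 j) s) x)%g.
Proof.
elim: s i j => [|x [|y s] IH] [|i] [|j] //= lti ltj; rewrite ?big_nil //.
  by rewrite !big_cons mulgA.
by rewrite bumpS !big_cons IH.
Qed.

(** Dropping the initial vertex e makes h_1 the new one; factoring it out is
    what puts a nontrivial group element in front of this face only. *)
Lemma omit0_bar_tuple r (t : r.+1.-tuple gT) :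
  omit ord0 (bar_tuple t) = diag_act (thead t) (bar_tuple (behead_tuple t)).
Proof.
apply/eq_from_tnth=> j; rewrite !tnth_map !tnth_ord_tuple.
by case/tupleP: t => x t; rewrite theadE /= big_cons.
Qed.

Lemma omit_lift_bar_tuple r (t : r.+1.-tuple gT) (i : 'I_r.+1) :
  omit (lift ord0 i) (bar_tuple t) = bar_tuple (bar_merge_tuple t i).
Proof.
apply/eq_from_tnth=> j; rewrite !tnth_map !tnth_ord_tuple.
by rewrite prod_take_bar_merge ?size_tuple.
Qed.

Lemma std_bd_bar r (t : r.+1.-tuple gT) :
  std_bd (bar R t) = gbase R (thead t) *: bar R (behead_tuple t)
    - \sum_(i < r.+1) (-1) ^+ i *: bar R (bar_merge_tuple t i).
Proof.
rewrite std_bd_tens big_ord_recl scale1r omit0_bar_tuple scale_tens -sumrN.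
congr (_ + _); apply: eq_bigr => i _.
by rewrite omit_lift_bar_tuple lift0 exprS mulN1r scaleNr.
Qed.

(** The coboundary of phi without its first term, and with opposite sign; this
    part does not see the group action, so it serves for trivial coefficients
    and for coefficients in the group ring alike. *)
Definition merge_sum (phi : seq gT -> A) (s : seq gT) : A :=
  \sum_(i < size s) (-1) ^+ i * phi (bar_merge s i).

Lemma merge_sum1 phi x : merge_sum phi [:: x] = phi [::].
Proof. by rewrite /merge_sum big_ord1 mul1r. Qed.

(** The recursion behind the Leibniz rule: all the faces but the first leave
    the first entry alone, with signs shifted by one. *)
Lemma merge_sum_cons2 phi x y s :
  merge_sum phi [:: x, y & s] =
    phi ((x * y)%g :: s) - merge_sum (fun u => phi (x :: u)) (y :: s).
Proof.
rewrite /merge_sum big_ord_recl mul1r -sumrN; congr (_ + _).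
by apply: eq_bigr => i _; rewrite lift0 exprS mulN1r mulNr.
Qed.

Lemma merge_sumZ (a : A) phi s : (forall b : A, GRing.comm a b) ->
  merge_sum (fun u => a * phi u) s = a * merge_sum phi s.
Proof.
move=> ca; rewrite /merge_sum mulr_sumr; apply: eq_bigr => i _.
by rewrite !mulrA ca.
Qed.

Lemma linear_std_bd_bar r (F : {linear stdRes R gT r -> A^o})
    (phi : seq gT -> A) (t : r.+1.-tuple gT) :
  (forall u : r.-tuple gT, F (bar R u) = phi u) ->
  F (std_bd (bar R t)) = gbase R (thead t) * phi (behead t) - merge_sum phi t.
Proof.
move=> F_bar; rewrite std_bd_bar linearB linearZ linear_sum /= F_bar.
congr (_ - _); rewrite /merge_sum size_tuple.
by apply: eq_bigr => i _; rewrite linearZ /= F_bar.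
Qed.

(** Substituting u := h v^-1 in the convolution exchanges the two factors, up
    to the order of a product in the group. *)
Lemma gr_mulC : abelian [set: gT] -> forall x y : A, x * y = y * x.
Proof.
move=> /centsP cG x y; apply/ffunP=> h; rewrite !gr_mulE.
rewrite (reindex_inj (inj_comp (mulgI h) invg_inj)) /=.
apply: eq_bigr => u _; rewrite invMg invgK mulgKV mulrC.
by rewrite (cG h _ u^-1%g) ?inE.
Qed.

End BarBoundary.

Section Carry.
Variables (R : comPzRingType) (gT : finGroupType) (g : gT).
Hypothesis gen_g : [set: gT] = <[g]>%g.
Local Notation A := (groupRing R gT).
Local Notation k := #[g]%g.

Definition carry (x y : gT) : bool := (k <= expo g x + expo g y)%N.

Let expoE x : (g ^+ expo g x)%g = x /\ (expo g x < k)%N.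
Proof. by apply: expoP; rewrite -gen_g inE. Qed.

Lemma expo_carry x y :
  (expo g x + expo g y = expo g (x * y)%g + carry x y * k)%N.
Proof.
have [Ex ltx] := expoE x; have [Ey lty] := expoE y.
rewrite -{2}Ex -{2}Ey -expgD /carry; case: leqP => le; last first.
  by rewrite expoX // addn0.
rewrite -{2}(subnK le) expgD expg_order mulg1 expoX ?mul1n ?subnK //.
by lia.
Qed.

(** Both sides count how often k is subtracted when the three exponents are
    added and reduced, in the two ways of bracketing. *)
Lemma carry_cocycle x y z :
  (carry x y + carry (x * y)%g z = carry y z + carry x (y * z)%g)%N.
Proof.
have k0 : (0 < k)%N := order_gt0 g.
apply/eqP; rewrite -(eqn_pmul2r k0) !mulnDl; apply/eqP.
have assoc : expo g (x * (y * z))%g = expo g (x * y * z)%g by rewrite mulgA.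
have := expo_carry x y; have := expo_carry (x * y)%g z.
have := expo_carry y z; have := expo_carry x (y * z)%g.
rewrite assoc; do 4![move: (carry _ _ * k)%N => ?]; lia.
Qed.

Lemma strongly_alternating_cons2 x y s :
  strongly_alternating g [:: x, y & s] = carry x y && strongly_alternating g s.
Proof.
apply/forallP/andP=> [H|[c /forallP H] [[|i] lti]] //=.
  split; first exact: (H ord0).
  by apply/forallP=> i; have := H (lift ord0 i).
exact: (H (Ordinal (lti : (i < (size s)./2)%N))).
Qed.

Lemma fval_even_cons2 x y s :
  fval_even R g [:: x, y & s] = (carry x y)%:R * fval_even R g s.
Proof.
rewrite /fval_even strongly_alternating_cons2.
by case: (carry x y); rewrite ?mul1r ?mul0r.
Qed.

Let commA : forall x y : A, x * y = y * x.
Proof. by apply: gr_mulC; rewrite gen_g cycle_abelian. Qed.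

(** The cup power of the carry cocycle is a cocycle for the trivial action.
    Two entries y, z are peeled off at a time; the first two faces and the
    induction hypothesis contribute
    (c(xy, z) - c(x, yz) + c(x, y)) c^s, which the cocycle identity
    collapses to c(y, z) c^s. *)
Lemma merge_sum_even x s : ~~ odd (size s) ->
  merge_sum (fval_even R g) (x :: s) = fval_even R g s.
Proof.
have [n] := ubnP (size s); elim: n => // n IH in x s *.
case: s => [|y [|z s]] //=; first by rewrite merge_sum1.
rewrite negbK => /ltnW lt_s ev_s; rewrite !merge_sum_cons2.
have -> : merge_sum (fun u => fval_even R g [:: x, y & u]) (z :: s) =
    (carry x y)%:R * fval_even R g s.
  rewrite -(IH z s lt_s ev_s) -merge_sumZ; last exact: commA.
  by apply: eq_bigr => i _; rewrite fval_even_cons2.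
rewrite !fval_even_cons2 opprB addrCA addrA -mulrDl -natrD.
rewrite carry_cocycle natrD mulrDl; exact: addrK.
Qed.

Lemma sigma_add a b : sigma_ R g (a + b) =
  sigma_ R g a + gbase R (g ^+ a)%g * sigma_ R g b.
Proof.
rewrite /sigma_ big_split_ord mulr_sumr; congr (_ + _).
by apply: eq_bigr => i _; rewrite -gbaseM -expgD.
Qed.

Lemma tau_sigma a : tau R g * sigma_ R g a = gbase R (g ^+ a)%g - 1.
Proof.
elim: a => [|a IH]; first by rewrite /sigma_ big_ord0 mulr0 expg0 subrr.
rewrite /sigma_ big_ord_recr /= mulrDr IH /tau mulrBl mul1r -gbaseM -expgS.
by rewrite addrC addrA subrK.
Qed.

(** For x = g^a, splitting sigma_(a + k) after a or after k terms gives
    sigma_a + x sigma = sigma + sigma_a. *)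
Lemma gbase_sigma x : gbase R x * sigma R g = sigma R g.
Proof.
have [<- _] := expoE x; have := sigma_add (expo g x) k.
rewrite addnC sigma_add expg_order gbase1 mul1r addrC => /addrI.
exact: esym.
Qed.

(** The exponent sum is expo (xy) plus a possible k, and the surplus k powers
    of g, translated by xy, still add up to sigma. *)
Lemma sigma_expo_coboundary x y :
  gbase R x * sigma_ R g (expo g y) - sigma_ R g (expo g (x * y)%g)
    + sigma_ R g (expo g x) = (carry x y)%:R * sigma R g.
Proof.
rewrite addrAC [X in X - _]addrC -{2}(expoE x).1 -sigma_add expo_carry.
rewrite sigma_add (expoE (x * y)%g).1 addrC addKr.
case: (carry x y); first by rewrite !mul1n mul1r gbase_sigma.
by rewrite /sigma_ big_ord0 mulr0 mul0r.
Qed.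

Definition fval_odd (s : seq gT) : A :=
  sigma_ R g (expo g (head 1%g s)) * fval_even R g (behead s).

Lemma even_coboundary x s : ~~ odd (size s) ->
  gbase R x * fval_even R g s - merge_sum (fval_even R g) (x :: s) =
    tau R g * fval_odd (x :: s).
Proof.
move=> ev; rewrite merge_sum_even // /fval_odd /= mulrA tau_sigma.
by rewrite (expoE x).1 mulrBl mul1r.
Qed.

Lemma odd_coboundary x y s : ~~ odd (size s) ->
  gbase R x * fval_odd (y :: s) - merge_sum fval_odd [:: x, y & s] =
    sigma R g * fval_even R g [:: x, y & s].
Proof.
move=> ev; rewrite merge_sum_cons2 /fval_odd /= merge_sumZ; last exact: commA.
rewrite merge_sum_even // fval_even_cons2 !mulrA.
rewrite [sigma R g * _]commA -sigma_expo_coboundary mulrDl mulrBl.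
by rewrite opprB addrA addrAC.
Qed.

Lemma f_bd_bar r (t : r.+1.-tuple gT) :
  f R g r (std_bd (bar R t)) = min_bd g (f R g r.+1 (bar R t)).
Proof.
pose phi := if odd r then fval_odd else fval_even R g.
rewrite (@linear_std_bd_bar _ _ _ (f R g r) phi) => [|u]; last first.
  by rewrite /f /= bar_extend_bar /fval /phi; case: ifP.
rewrite /f /= bar_extend_bar /min_bd /fval {}/phi /=.
have := size_tuple t; case/tupleP: t => x t; rewrite theadE /=.
case: ifP => /= or; last by rewrite even_coboundary // size_tuple or.
case: r or t => // r or; case/tupleP => y t _ /=.
by rewrite odd_coboundary // size_tuple.
Qed.

End Carry.

Theorem proposition3p8 (R : comPzRingType) (k : nat) (gT : finGroupType)
    (g : gT) (hk : (2 <= k)%N) (hg : [set: gT] = <[g]>%g) (gk : #[g]%g = k) :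
  is_chain_map (@std_bd R gT) (@min_bd R gT g) (@f R gT g)
  /\ (forall s : nat,
       (forall c : stdRes R gT s.*2.+1,
          f R g s.*2 (std_bd c) = tau R g * f R g s.*2.+1 c)
       /\ (forall c : stdRes R gT s.*2.+2,
          f R g s.*2.+1 (std_bd c) = sigma R g * f R g s.*2.+2 c)).
Proof.
have chain : is_chain_map (@std_bd R gT) (@min_bd R gT g) (@f R gT g).
  move=> r c; rewrite [c]bar_decomp !linear_sum /min_bd mulr_sumr /=.
  apply: eq_bigr => t _; rewrite !linearZ /= f_bd_bar // /min_bd.
  have commA := @gr_mulC R gT; rewrite hg cycle_abelian in commA.
  by rewrite /GRing.scale /= !mulrA (commA isT (bar_coef c t)).
split=> // s; split=> c; rewrite chain /min_bd /= odd_double //.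
Qed.
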